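(* One has $$\mathbb Z_{(2)}[f_0,f_1]\cdot 1=\mathbb Z_{(2)}[e_0,e_1,f_0,f_1]\cdot 1=\Delta,$$ where $1\in R$ is the constant polynomial, and for a set $S$ of operators, $\mathbb Z_{(2)}[S]\cdot 1$ denotes the $\mathbb Z_{(2)}$-submodule of $R$ spanned by all vectors $X_1X_2\cdots X_m 1$ with $m\ge0$ and $X_1,\dots,X_m\in S$.
   Context: Let $R=\mathbb C[p_1,p_3,p_5,\ldots]$ be the polynomial ring in variables $p_k$ indexed by odd positive integers $k$ (the basic representation of $\widehat{\mathfrak{sl}_2}$). Define operators on $R$: $\alpha_k^*$ = multiplication by $p_k$, and $\alpha_k=k\,\partial/\partial p_k$, for odd $k\ge1$; and operators $A_j$ ($j\in\mathbb Z$) by the identity of formal series in $z$ $$\sum_{j\in\mathbb Z} z^{-j}A_j=\frac12\exp\Big(-2\sum_{k\ge1\text{ odd}}\frac{p_k}{k}z^k\Big)\exp\Big(2\sum_{k\ge1\text{ odd}}\frac{\partial}{\partial p_k}z^{-k}\Big).$$ The Chevalley generators act by $$e_0=\tfrac12(\alpha_1+A_1),\quad e_1=\tfrac12(\alpha_1-A_1),\quad f_0=\tfrac12(\alpha_1^*-A_{-1}),\quad f_1=\tfrac12(\alpha_1^*+A_{-1}).$$ Let $\mathbb Z_{(2)}=\{a/b: a,b\in\mathbb Z,\ b\text{ odd}\}$ and $\Delta=\mathbb Z_{(2)}[p_1,2p_3,4p_5,\ldots]=\mathbb Z_{(2)}[2^kp_{2k+1}:k\ge0]\subset R$. *)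

(* Defs.v *)
From mathcomp Require Import all_boot all_order all_algebra.
From mathcomp Require Import finmap.
From mathcomp Require Import boolp classical_sets fsbigop reals.
From mathcomp Require Import complex.
From mathcomp Require Import monalg.

Set Implicit Arguments.
Unset Strict Implicit.
Unset Printing Implicit Defensive.

Import GRing.Theory Num.Theory.

Local Open Scope classical_set_scope.
Local Open Scope ring_scope.

Section LatticeOfBasicRepresentation.
Variable R : realType.

Notation C := R[i].

(* C[p_1, p_3, p_5, ...]; the variable with index i : nat is p_(2i+1). *)
Definition polyring := {malg C[{cmonom nat}]}.

(* Only meaningful for odd k, where k = 2 * k./2 + 1; for even k it is junk
   and is never used below. *)
Definition p (k : nat) : polyring := << 1 *g ucm k./2 >>.

(* d/dp_k, for odd k. When p_k does not occur in m, the truncated monomial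
   division is harmless because the coefficient is 0. *)
Definition dp (k : nat) (f : polyring) : polyring :=
  \sum_(m <- msupp f) << f@_m *+ m k./2 *g divcm m (ucm k./2) >>.

Definition alpha_star (k : nat) (f : polyring) : polyring := p k * f.

Definition alpha (k : nat) (f : polyring) : polyring := k%:R *: dp k f.

(* Formal power series in one variable t whose coefficients are operators on
   polyring: F n is the coefficient of t^n. *)
Definition opseries := nat -> polyring -> polyring.

Definition opseries1 : opseries := fun n f => if n == 0%N then f else 0.

Definition opseriesM (F G : opseries) : opseries :=
  fun n f => \sum_(i < n.+1) F i (G (n - i)%N f).

Definition opseriesX (F : opseries) (r : nat) : opseries :=
  iter r (opseriesM F) opseries1.

(* exp F = \sum_r F^r / r!, for F without constant term: F^r then starts in
   degree >= r, so only r <= n contribute to the coefficient of t^n. *)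
Definition opseries_exp (F : opseries) : opseries :=
  fun n f => \sum_(r < n.+1) (r`!%:R)^-1 *: opseriesX F r n f.

(* exp (- 2 \sum_(k odd) p_k / k z^k), as a series in t = z. *)
Definition exp_p : opseries :=
  opseries_exp (fun k f => if odd k then - (2 / k%:R) *: (p k * f) else 0).

(* exp (2 \sum_(k odd) d/dp_k z^-k), as a series in t = z^-1. *)
Definition exp_dp : opseries :=
  opseries_exp (fun k f => if odd k then 2 *: dp k f else 0).

(* The coefficient of z^-j in the product of the two series: the sum of
   exp_p n \o exp_dp m over all n, m with z^n z^-m = z^-j. On a given f this
   sum is finite: exp_dp m lowers the degree (with p_k of degree k) by m, so
   it kills f for m large. *)
Definition A (j : int) (f : polyring) : polyring :=
  2^-1 *: \sum_(nm \in [set nm : nat * nat | nm.2%:Z - nm.1%:Z = j])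
    exp_p nm.1 (exp_dp nm.2 f).

Definition e0 (f : polyring) : polyring := 2^-1 *: (alpha 1 f + A 1 f).
Definition e1 (f : polyring) : polyring := 2^-1 *: (alpha 1 f - A 1 f).
Definition f0 (f : polyring) : polyring := 2^-1 *: (alpha_star 1 f - A (-1) f).
Definition f1 (f : polyring) : polyring := 2^-1 *: (alpha_star 1 f + A (-1) f).

Definition Z2 : set C :=
  [set x | exists a b : int, odd `|b| /\ x = a%:~R / b%:~R].

Definition Z2submod_closed (M : set polyring) : Prop :=
  [/\ M 0, forall u v, M u -> M v -> M (u + v)
    & forall c u, Z2 c -> M u -> M (c *: u)].

Definition Z2span (G : set polyring) : set polyring :=
  smallest Z2submod_closed G.

(* The vectors X_1 X_2 ... X_m 1 with m >= 0 and all X_i in S. *)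
Definition words1 (S : set (polyring -> polyring)) : set polyring :=
  [set v | exists2 Xs : seq (polyring -> polyring),
     (forall i, (i < size Xs)%N -> S (nth id Xs i)) &
     v = foldr (fun X w => X w) 1 Xs].

Definition Z2orbit (S : set (polyring -> polyring)) : set polyring :=
  Z2span (words1 S).

(* The subring of polyring generated by the constants in Z_(2) and by G. *)
Definition Z2alg (G : set polyring) : set polyring :=
  smallest (fun B : set polyring => GRing.subring_closed [in B])
    ([set c%:MP | c in Z2] `|` G).

Definition Delta : set polyring :=
  Z2alg [set 2 ^+ k *: p k.*2.+1 | k in [set: nat]].

End LatticeOfBasicRepresentation.

Arguments e0 R f : clear implicits.
Arguments e1 R f : clear implicits.
Arguments f0 R f : clear implicits.
Arguments f1 R f : clear implicits.
Arguments Delta R : clear implicits.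

(* Main.v *)
Require Import Defs.
From mathcomp Require Import all_boot all_order all_algebra.
From mathcomp Require Import finmap.
From mathcomp Require Import boolp classical_sets fsbigop reals.
From mathcomp Require Import complex.
From mathcomp Require Import monalg ring zify.

(* Put x_i = 2^i p_(2i+1), so that Delta = Z_(2)[x_0, x_1, ...], graded by
   deg x_i = 2i+1, and write exp(-2 sum p_k z^k / k) = sum E_n z^n.  From
   E' = -2 (sum p_k z^(k-1)) E and E(z) E(-z) = 1, the vectors
   2^i A_(-2i-1) 1 = 2^(i-1) E_(2i+1) and 2^i A_(-2i-2) 1 = 2^(i-1) E_(2i+2)
   lie in Delta, the former being -x_i / (2i+1) modulo 2 Delta.  The relation
   [A_j, p_k] = 2 A_(j-k) propagates this from 1 to all of Delta: modulo 2
   Delta the operator 2^i A_(-2i-1) is multiplication by -x_i / (2i+1), and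
   A_1 agrees with alpha_1.  Hence the four generators preserve Delta.

   Conversely, the orbit M of 1 under f_0 and f_1 is stable under p_1 = f_0 + f_1
   and A_(-2) = [f_1, p_1].  Since [A_(-2), x_i] = 2^(i+1) A_(-2i-3) is
   multiplication by -x_(i+1) / (2i+3) modulo 2, M + 2 Delta is stable under
   every x_i, so it is Delta.  This holds in each bounded degree, where
   everything is finitely generated, and Nakayama's lemma gives M = Delta. *)

Set Implicit Arguments.
Unset Strict Implicit.
Unset Printing Implicit Defensive.

Import Order.TTheory GRing.Theory Num.Theory.

Local Open Scope ring_scope.
Section OperatorSeries.
Variables (F : fieldType) (V : comAlgType F).
Implicit Types (T : nat -> V -> V) (c : nat -> V).

(* The definitions of Defs.v with an arbitrary algebra in place of polyring. *)
Definition series1 : nat -> V -> V := fun n f => if n == 0 then f else 0.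

Definition seriesM T1 T2 : nat -> V -> V :=
  fun n f => \sum_(i < n.+1) T1 i (T2 (n - i)%N f).

Definition seriesX T r : nat -> V -> V := iter r (seriesM T) series1.

Definition series_exp T : nat -> V -> V :=
  fun n f => \sum_(r < n.+1) (r`!%:R)^-1 *: seriesX T r n f.

Lemma seriesXS T r n f :
  seriesX T r.+1 n f = \sum_(i < n.+1) T i (seriesX T r (n - i)%N f).
Proof. by []. Qed.

Lemma seriesX0 T n f : (forall g, T 0 g = 0) -> (forall k, T k 0 = 0) ->
  forall r, (n < r)%N -> seriesX T r n f = 0.
Proof.
move=> T0 Tz r; elim: r n => // r IHr n; rewrite ltnS => ler.
rewrite seriesXS big1 // => -[[|i] iP] _ /=; first exact: T0.
rewrite IHr ?Tz //; move: iP; rewrite ltnS => iP.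
by apply: leq_trans ler; rewrite ltn_subrL /= (leq_trans _ iP).
Qed.

Section Multiplication.
Variable c : nat -> V.
Hypothesis c0 : c 0 = 0.

Let mulc k f := c k * f.

Lemma seriesX_mul r n N f : (n < N)%N ->
  seriesX mulc r n f = ((\poly_(i < N) c i) ^+ r)`_n * f.
Proof.
elim: r n => [|r IHr] n ltnN.
  by rewrite expr0 coef1 /= /series1; case: eqP; rewrite ?mul1r ?mul0r.
rewrite seriesXS exprS coefM mulr_suml; apply: eq_bigr => i _.
have lei : (i <= n)%N by rewrite -ltnS.
rewrite {1}/mulc IHr ?(leq_ltn_trans (leq_subr _ _)) //.
by rewrite coef_poly (leq_ltn_trans lei) // mulrA.
Qed.

Lemma series_exp_mul n f : series_exp mulc n f = series_exp mulc n 1 * f.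
Proof.
rewrite mulr_suml; apply: eq_bigr => r _.
by rewrite !(seriesX_mul _ _ (ltnSn n)) mulr1 scalerAl.
Qed.

Lemma series_exp_mul0 : series_exp mulc 0 1 = 1.
Proof. by rewrite /series_exp big_ord1 /= fact0 invr1 scale1r. Qed.

End Multiplication.

End OperatorSeries.

Section ScalarExponential.
Variables (F : numFieldType) (V : comAlgType F) (c : nat -> V).
Hypothesis c0 : c 0 = 0.

Let E n := series_exp (fun k f => c k * f) n 1.

Lemma series_exp_coef N M m : (m < N)%N -> (m < M)%N ->
  E m = \sum_(r < M) (r`!%:R)^-1 *: ((\poly_(i < N) c i) ^+ r)`_m.
Proof.
move=> ltmN ltmM; rewrite /E /series_exp.
rewrite (big_ord_widen M (fun r => (r`!%:R)^-1 *: seriesX _ r m _) ltmM).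
rewrite [RHS](bigID (fun r : 'I_M => (r < m.+1)%N)) /= [X in _ + X]big1 ?addr0.
  by apply: eq_bigr => r _; rewrite (seriesX_mul _ _ _ ltmN) mulr1.
move=> r; rewrite -leqNgt => ltmr.
rewrite -[_`_m]mulr1 -(seriesX_mul _ _ _ ltmN) seriesX0 ?scaler0 // => [g|k].
  by rewrite c0 mul0r.
by rewrite mulr0.
Qed.

(* Coefficient of z^n in E' = c' E. *)
Lemma series_exp_rec n :
  n.+1%:R * E n.+1 = \sum_(k < n.+1) k.+1%:R * c k.+1 * E (n - k)%N.
Proof.
set P := \poly_(i < n.+2) c i.
rewrite (@series_exp_coef n.+2 n.+2 n.+1) // -/P mulr_sumr big_ord_recl /=.
rewrite expr0 coef1 scaler0 mulr0 add0r.
transitivity (\sum_(r < n.+1) (r`!%:R)^-1 *: (P^`() * P ^+ r)`_n).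
  apply: eq_bigr => r _; rewrite /bump /= add1n.
  rewrite -scalerAr mulr_natl -coef_deriv deriv_exp /= coefMn factS natrM.
  rewrite -scaler_nat invfM scalerA mulrAC mulVf ?mul1r //.
  by rewrite pnatr_eq0.
transitivity (\sum_(k < n.+1) \sum_(r < n.+1)
    (r`!%:R)^-1 *: (P^`()`_k * (P ^+ r)`_(n - k))).
  by rewrite exchange_big; apply: eq_bigr => r _; rewrite coefM scaler_sumr.
apply: eq_bigr => k _; rewrite (@series_exp_coef n.+2 n.+1); last 2 first.
- by apply: leq_ltn_trans (leq_subr _ _) _.
- by rewrite ltnS leq_subr.
rewrite mulr_sumr; apply: eq_bigr => r _.
by rewrite coef_deriv coef_poly ltnS ltn_ord -scalerAr mulr_natl.
Qed.

(* E(z) E(-z) = 1 for odd c, as its derivative vanishes. *)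
Lemma series_exp_odd n : (forall k, ~~ odd k -> c k = 0) ->
  \sum_(a < n.+2) (-1) ^+ a * E a * E (n.+1 - a)%N = 0.
Proof.
move=> ceven.
pose e := \poly_(i < n.+2) E i; pose e' := \poly_(i < n.+2) ((-1) ^+ i * E i).
pose d := \poly_(i < n.+1) (i.+1%:R * c i.+1).
have eP i : (i < n.+1)%N -> e^`()`_i = (d * e)`_i.
  move=> lti; rewrite coef_deriv coef_poly ltnS lti -mulr_natl series_exp_rec.
  rewrite coefM; apply: eq_bigr => k _.
  have ltk : (k < n.+1)%N by rewrite (leq_ltn_trans _ lti) // -ltnS.
  rewrite !coef_poly ltk (leq_ltn_trans (leq_subr _ _)) //.
  exact: ltn_trans lti _.
have e'P i : (i < n.+1)%N -> e'^`()`_i = - (d * e')`_i.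
  move=> lti; rewrite coef_deriv coef_poly ltnS lti -mulrnAr -mulr_natl.
  rewrite series_exp_rec mulr_sumr coefM -sumrN; apply: eq_bigr => k _.
  have lek : (k <= i)%N by rewrite -ltnS.
  rewrite !coef_poly (leq_ltn_trans lek) // (leq_ltn_trans (leq_subr _ _)) //;
    last exact: ltn_trans lti _.
  have [ok|/ceven ->] := boolP (odd k.+1); last by rewrite !(mulr0, mul0r, oppr0).
  rewrite -{1}(subnK lek) -addnS exprD -(signr_odd _ k.+1) ok /= expr1.
  move: ((-1) ^+ _) => u; ring.
have dlow (q r : {poly V}) s : (forall i, (i < n.+1)%N -> q`_i = r`_i) ->
    (q * s)`_n = (r * s)`_n.
  by move=> qr; rewrite !coefM; apply: eq_bigr => i _; rewrite qr.
have : ((e' * e)^`())`_n = 0.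
  rewrite derivM coefD (dlow _ (- (d * e'))) => [|i /e'P ->]; last by rewrite coefN.
  rewrite [e' * _]mulrC (dlow _ _ _ eP) mulNr coefN.
  by rewrite mulrAC addNr.
rewrite coef_deriv -mulr_natl coefM => eq0.
have /(congr1 (fun v => n.+1%:R^-1 *: v)) := eq0.
rewrite scaler0 scalerAl -scaler_nat scalerA mulVf ?pnatr_eq0 // scale1r mul1r.
move=> s0; rewrite -[RHS]s0; apply: eq_bigr => a _.
by rewrite !coef_poly ltn_ord ltnS leq_subr.
Qed.

End ScalarExponential.

Section Annihilation.
Variables (F : numFieldType) (V : comAlgType F).
Variables (p : nat -> V) (dp : nat -> V -> V).
Hypothesis dp_linear : forall k, linear (dp k).
Hypothesis dp1 : forall k, odd k -> dp k 1 = 0.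
Hypothesis dpM : forall k l f, odd k -> odd l ->
  dp k (p l * f) = p l * dp k f + f *+ (k == l).
Hypothesis p_ind : forall P : V -> Prop, P 1 ->
  (forall a u v, P u -> P v -> P (a *: u + v)) ->
  (forall k u, odd k -> P u -> P (p k * u)) -> forall u, P u.

Let T k f := if odd k then 2 *: dp k f else 0.

Local Lemma T_linear k : linear (T k).
Proof.
move=> a u v; rewrite /T; case: ifP => _; last by rewrite scaler0 addr0.
by rewrite dp_linear scalerDr !scalerA [2 * a]mulrC.
Qed.

Local Lemma T0 k : T k 0 = 0.
Proof. by have := T_linear k (-1) 0 0; rewrite scaler0 addr0 scaleN1r addNr. Qed.

Local Lemma TD k u v : T k (u + v) = T k u + T k v.
Proof. by have := T_linear k 1 u v; rewrite !scale1r. Qed.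

Local Lemma TZ k a u : T k (a *: u) = a *: T k u.
Proof. by have := T_linear k a u 0; rewrite T0 !addr0. Qed.

Local Lemma TM k l f : odd l -> T k (p l * f) = p l * T k f + (2 *: f) *+ (k == l).
Proof.
rewrite /T => ol; have [ok|nk] := boolP (odd k).
  by rewrite dpM // scalerDr scalerAr scalerMnr.
by rewrite mulr0 add0r (_ : (k == l) = false) //; apply: contraNF nk => /eqP ->.
Qed.

Local Lemma seriesX_linear r m : linear (seriesX T r m).
Proof.
elim: r m => [|r IHr] m a u v.
  by rewrite /= /series1; case: eqP => // _; rewrite scaler0 addr0.
rewrite !seriesXS scaler_sumr -big_split; apply: eq_bigr => i _ /=.
by rewrite IHr T_linear.
Qed.

Lemma series_exp_linear m : linear (series_exp T m).
Proof.
move=> a u v; rewrite /series_exp scaler_sumr -big_split.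
by apply: eq_bigr => r _ /=; rewrite seriesX_linear scalerDr !scalerA [_^-1 * a]mulrC.
Qed.

Local Lemma seriesXM r m l f : odd l ->
  seriesX T r m (p l * f) = p l * seriesX T r m f +
    (if (l <= m)%N then (2 * r%:R) *: seriesX T r.-1 (m - l) f else 0).
Proof.
move=> ol; elim: r m => [|r IHr] m.
  by rewrite mulr0 scale0r if_same addr0 /= /series1; case: eqP; rewrite ?mulr0.
rewrite !seriesXS mulr_sumr.
under eq_bigr do rewrite IHr TD TM //.
rewrite !big_split /= -addrA; congr (_ + _).
have -> : \sum_(i < m.+1) (2 *: seriesX T r (m - i) f) *+ (nat_of_ord i == l) =
          if (l <= m)%N then 2 *: seriesX T r (m - l) f else 0.
  have := big_ord1_eq +%R (fun i => 2 *: seriesX T r (m - i) f) l m.+1.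
  rewrite ltnS => <-; rewrite [RHS]big_mkcond /=.
  by apply: eq_bigr => i _; case: eqP.
case: leqP => lem; last first.
  rewrite add0r big1 // => i _; rewrite leqNgt ifF ?T0 //.
  by apply/negbF; rewrite (leq_ltn_trans (leq_subr _ _)).
rewrite [r.+1%:R]mulrS mulrDr mulr1 [(2 + _) *: _]scalerDl; congr (_ + _).
case: r IHr => [|r] _.
  by rewrite mulr0 scale0r big1 // => i _; rewrite ?mulr0 scale0r if_same T0.
rewrite seriesXS scaler_sumr.
rewrite (big_ord_widen m.+1
  (fun i => (2 * r.+1%:R) *: T i (seriesX T r (m - l - i) f))) ?ltnS ?leq_subr //.
rewrite [RHS]big_mkcond /=; apply: eq_bigr => i _.
have -> : (l <= m - i)%N = (i < (m - l).+1)%N.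
  rewrite ltnS; have : (i <= m)%N by rewrite -ltnS.
  lia.
by case: ifP => _; rewrite ?T0 // TZ subnAC.
Qed.

Lemma series_expM m l f : odd l -> series_exp T m (p l * f) =
  p l * series_exp T m f + (if (l <= m)%N then 2 *: series_exp T (m - l) f else 0).
Proof.
move=> ol; rewrite /series_exp mulr_sumr.
under eq_bigr do rewrite seriesXM // scalerDr.
rewrite big_split /=; congr (_ + _).
  by apply: eq_bigr => r _; rewrite scalerAr.
case: leqP => lem; last by rewrite big1 // => r _; rewrite scaler0.
rewrite big_ord_recl /= mulr0 scale0r scaler0 add0r scaler_sumr.
have ltl : ((m - l).+1 <= m)%N by have := odd_gt0 ol; lia.
rewrite (big_ord_widen m (fun r => 2 *: ((r`!%:R)^-1 *: seriesX T r (m - l) f)) ltl).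
rewrite [RHS]big_mkcond /=; apply: eq_bigr => r _.
rewrite /bump /= add1n factS natrM ltnS.
have [ler|ltr] := leqP r (m - l)%N.
  rewrite !scalerA; congr (_ *: _); rewrite invfM.
  by rewrite mulrC -mulrA mulVKf ?pnatr_eq0.
by rewrite seriesX0 ?scaler0 //; exact: T0.
Qed.

Lemma series_exp0 f : series_exp T 0 f = f.
Proof. by rewrite /series_exp big_ord1 /= fact0 invr1 scale1r. Qed.

Lemma series_exp1 m : series_exp T m.+1 1 = 0.
Proof.
have X1 r n : seriesX T r n 1 = ((r == 0) && (n == 0))%:R.
  elim: r n => [|r IHr] n; first by rewrite /= /series1; case: eqP.
  rewrite seriesXS big1 // => i _; rewrite IHr.
  case: (_ && _); last exact: T0.
  by rewrite /T; case: ifP => // /dp1 ->; rewrite scaler0.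
by rewrite /series_exp big1 // => r _; rewrite X1 andbF scaler0.
Qed.

Lemma series_exp_nilpotent f :
  exists M, forall m, (M <= m)%N -> series_exp T m f = 0.
Proof.
elim/p_ind: f => [|a u v [M Mu] [N Nv]|l u ol [M Mu]].
- by exists 1%N => -[//|m] _; exact: series_exp1.
- exists (maxn M N) => m; rewrite geq_max => /andP[Mm Nm].
  by rewrite series_exp_linear Mu ?Nv // scaler0 addr0.
exists (l + M)%N => m lem; rewrite series_expM // Mu; last by lia.
by rewrite mulr0 add0r Mu ?scaler0 ?if_same //; lia.
Qed.

Section VertexOperator.
Variables (E : nat -> V) (A : int -> V -> V).

Definition extend0 (j : int) : V := if j is Posz n then E n else 0.

Hypothesis AE : forall j f M, (forall m, (M <= m)%N -> series_exp T m f = 0) ->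
  A j f = 2^-1 *: \sum_(m < M) extend0 (m%:Z - j) * series_exp T m f.

Lemma vertex_linear j : linear (A j).
Proof.
move=> a u v.
have [M Mu] := series_exp_nilpotent u; have [N Nv] := series_exp_nilpotent v.
have MNu m : (maxn M N <= m)%N -> series_exp T m u = 0.
  by rewrite geq_max => /andP[/Mu].
have MNv m : (maxn M N <= m)%N -> series_exp T m v = 0.
  by rewrite geq_max => /andP[_ /Nv].
rewrite (AE _ MNu) (AE _ MNv) (@AE j _ (maxn M N)) => [|m lem]; last first.
  by rewrite series_exp_linear MNu ?MNv // scaler0 addr0.
rewrite scalerA [a * _]mulrC -scalerA -scalerDr; congr (_ *: _); rewrite scaler_sumr -big_split.
by apply: eq_bigr => m _ /=; rewrite series_exp_linear mulrDr scalerAr.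
Qed.

Lemma vertexM j l f : odd l -> A j (p l * f) = p l * A j f + 2 *: A (j - l%:Z) f.
Proof.
move=> ol; have [M Mf] := series_exp_nilpotent f.
have lMf m : (l + M <= m)%N -> series_exp T m f = 0 by move=> ?; apply: Mf; lia.
rewrite (AE _ lMf) (AE _ Mf) (@AE _ _ (l + M)) => [|m lem]; last first.
  rewrite series_expM // lMf // mulr0 add0r Mf ?scaler0 ?if_same //; lia.
under eq_bigr do rewrite series_expM // mulrDr.
rewrite big_split scalerDr /=; congr (_ + _).
  rewrite -scalerAr mulr_sumr; congr (_ *: _).
  by apply: eq_bigr => m _; rewrite mulrCA.
rewrite scalerA [2 * _]mulrC -scalerA; congr (_ *: _); rewrite big_split_ord /= big1 ?add0r.
  rewrite scaler_sumr; apply: eq_bigr => m _ /=.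
  rewrite leq_addr addKn scalerAr; congr (extend0 _ * _).
  lia.
by move=> m _; rewrite leqNgt ltn_ord mulr0.
Qed.

Lemma vertex1 j : A j 1 = 2^-1 *: extend0 (- j).
Proof.
rewrite (@AE _ _ 1) => [|[//|m _]]; last exact: series_exp1.
by rewrite big_ord1 series_exp0 mulr1 sub0r.
Qed.

End VertexOperator.
End Annihilation.

Section OddFractions.
Variables (F : numFieldType) (V : lmodType F).

Definition odd_fraction (x : F) : Prop :=
  exists a b : int, odd `|b| /\ x = a%:~R / b%:~R.

Local Lemma oddz_neq0 (b : int) : odd `|b| -> b%:~R != 0 :> F.
Proof. by move=> ob; rewrite intr_eq0; case: eqP ob => // ->. Qed.

Lemma odd_fraction_int (a : int) : odd_fraction a%:~R.
Proof. by exists a, 1; rewrite divr1. Qed.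

Lemma odd_fraction_nat n : odd_fraction n%:R.
Proof. exact: (odd_fraction_int n). Qed.

Lemma odd_fractionM x y : odd_fraction x -> odd_fraction y -> odd_fraction (x * y).
Proof.
move=> [a [b [ob ->]]] [c [d [od ->]]]; exists (a * c), (b * d).
by rewrite abszM oddM ob od !rmorphM invfM /= mulrACA.
Qed.

Lemma odd_fractionN x : odd_fraction x -> odd_fraction (- x).
Proof. by move=> [a [b [ob ->]]]; exists (- a), b; rewrite rmorphN mulNr. Qed.

Lemma odd_fractionD x y : odd_fraction x -> odd_fraction y -> odd_fraction (x + y).
Proof.
move=> [a [b [ob ->]]] [c [d [od ->]]]; exists (a * d + c * b), (b * d).
by rewrite abszM oddM ob od addf_div ?oddz_neq0 // !(rmorphD, rmorphM).
Qed.

Lemma odd_fractionV n : odd n -> odd_fraction n%:R^-1.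
Proof. by move=> on; exists 1, n%:Z; rewrite div1r. Qed.

Lemma odd_fraction_unit c : odd_fraction c ->
  1 - 2 * c != 0 /\ odd_fraction (1 - 2 * c)^-1.
Proof.
move=> [a [b [ob ->]]]; have b0 := oddz_neq0 ob.
have od : odd `|(b - 2 * a)%R|%N.
  by move: ob; lia.
have -> : 1 - 2 * (a%:~R / b%:~R) = (b - 2 * a)%:~R / b%:~R :> F.
  by rewrite rmorphB rmorphM /= mulrBl divff // mulrA.
split; first by rewrite mulf_neq0 ?invr_eq0 ?oddz_neq0.
by exists b, (b - 2 * a); rewrite invf_div.
Qed.

Definition zclosed (M : V -> Prop) : Prop :=
  [/\ M 0, forall u v, M u -> M v -> M (u + v)
    & forall c u, odd_fraction c -> M u -> M (c *: u)].

Definition zspan (G : V -> Prop) (v : V) : Prop :=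
  forall M, zclosed M -> (forall g, G g -> M g) -> M v.

Lemma zspan_closed G : zclosed (zspan G).
Proof.
split=> [M [M0 _ _]|u v uG vG M MC GM|c u cZ uG M MC GM] //.
  by case: (MC) => _ MD _; apply: MD; [apply: uG|apply: vG].
by case: (MC) => _ _ MZ; apply: MZ => //; apply: uG.
Qed.

Lemma zspan_gen (G : V -> Prop) g : G g -> zspan G g.
Proof. by move=> Gg M _; apply. Qed.

Lemma zspan_sub (G G' : V -> Prop) :
  (forall g, G g -> zspan G' g) -> forall v, zspan G v -> zspan G' v.
Proof. by move=> GG' v; apply=> //; apply: zspan_closed. Qed.

Section Closed.
Variable M : V -> Prop.
Hypothesis MC : zclosed M.

Lemma zclosed0 : M 0. Proof. by case: MC. Qed.
Lemma zclosedD u v : M u -> M v -> M (u + v). Proof. by case: MC => _ + _; apply. Qed.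
Lemma zclosedZ c u : odd_fraction c -> M u -> M (c *: u).
Proof. by case: MC => _ _; apply. Qed.
Lemma zclosed_nat n u : M u -> M (n%:R *: u).
Proof. exact/zclosedZ/odd_fraction_nat. Qed.
Lemma zclosedN u : M u -> M (- u).
Proof.
by rewrite -scaleN1r; apply/zclosedZ/odd_fractionN/(odd_fraction_nat 1).
Qed.
Lemma zclosedB u v : M u -> M v -> M (u - v).
Proof. by move=> Mu /zclosedN; apply: zclosedD. Qed.
Lemma zclosed_sum (I : Type) (r : seq I) (P : pred I) (G : I -> V) :
  (forall i, P i -> M (G i)) -> M (\sum_(i <- r | P i) G i).
Proof. by apply: big_ind; [exact: zclosed0|exact: zclosedD]. Qed.

Lemma zclosed_preim (T : V -> V) : linear T -> zclosed (fun u => M (T u)).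
Proof.
move=> T_linear.
have T0 : T 0 = 0.
  by have := T_linear (-1) 0 0; rewrite scaler0 addr0 scaleN1r addNr.
split=> [|u w|c u cZ]; first by rewrite T0; apply: zclosed0.
  by have := T_linear 1 u w; rewrite !scale1r => ->; apply: zclosedD.
by have := T_linear c u 0; rewrite T0 !addr0 => ->; apply: zclosedZ.
Qed.

End Closed.

Section Mod2.
Variable M : V -> Prop.
Hypothesis MC : zclosed M.

Definition mod2 (N : V -> Prop) (v : V) : Prop :=
  exists m n, [/\ M m, N n & v = m + 2 *: n].

Lemma mod2_closed N : zclosed N -> zclosed (mod2 N).
Proof.
move=> [N0 ND NZ]; split=> [|u v [m [n [Mm Nn ->]]] [m' [n' [Mm' Nn' ->]]]|].
- by exists 0, 0; split=> //; [exact: zclosed0|rewrite scaler0 addr0].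
- exists (m + m'), (n + n'); split; [exact: zclosedD|exact: ND|].
  by rewrite scalerDr addrACA.
- move=> c u cZ [m [n [Mm Nn ->]]]; exists (c *: m), (c *: n).
  split; [exact: zclosedZ|exact: NZ|].
  by rewrite scalerDr !scalerA [c * 2]mulrC.
Qed.

Lemma zspan_cons a (l : seq V) v : zspan (fun u => u \in a :: l) v ->
  exists c w, [/\ odd_fraction c, zspan (fun u => u \in l) w & v = c *: a + w].
Proof.
pose P u := exists c w,
  [/\ odd_fraction c, zspan (fun u => u \in l) w & u = c *: a + w].
move=> /(_ P); apply=> [|g]; last first.
  rewrite inE => /orP[/eqP ->|gl].
    exists 1, 0; split; [exact: (odd_fraction_nat 1)| |by rewrite scale1r addr0].
    by case: (zspan_closed (fun u => u \in l)).
  exists 0, g; split; [exact: (odd_fraction_nat 0)|exact: zspan_gen|].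
  by rewrite scale0r add0r.
have [S0 SD SZ] := zspan_closed (fun u => u \in l).
split=> [|u u' [c [w [cZ wl ->]]] [c' [w' [cZ' wl' ->]]]|].
- exists 0, 0; split; [exact: (odd_fraction_nat 0)|exact: S0|].
  by rewrite scale0r addr0.
- exists (c + c'), (w + w'); split; [exact: odd_fractionD|exact: SD|].
  by rewrite scalerDl addrACA.
- move=> c u cZ [b [w [bZ wl ->]]]; exists (c * b), (c *: w).
  split; [exact: odd_fractionM|exact: SZ|].
  by rewrite scalerDr scalerA.
Qed.

(* Eliminating one generator at a time, since 1 - 2 c is a unit. *)
Lemma zspan_nakayama (l : seq V) :
  (forall v, v \in l -> mod2 (zspan (fun u => u \in l)) v) ->
  forall v, v \in l -> M v.
Proof.
elim: l => // a l IHl hl.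
pose S := zspan (fun u => u \in l).
have [m [n [Mm /zspan_cons[c [w [cZ wl ->]]] aE]]] := hl a (mem_head _ _).
have [c1 c1Z] := odd_fraction_unit cZ.
have aE1 : a = (1 - 2 * c)^-1 *: (m + 2 *: w).
  rewrite -[LHS](scalerK c1); congr (_ *: _).
  by rewrite scalerBl scale1r {1}aE scalerDr scalerA -addrA [_ + _ - _]addrAC subrr add0r.
have SC : zclosed S := @zspan_closed _.
have [MS0 MSD MSZ] := mod2_closed SC.
have lM : forall v, v \in l -> M v.
  apply: IHl => v vl.
  have /hl[m' [n' [Mm' /zspan_cons[c' [w' [cZ' wl' ->]]] ->]]] : v \in a :: l.
    by rewrite inE vl orbT.
  apply: MSD.
    by exists m', 0; split=> //; [exact: (zclosed0 SC)|rewrite scaler0 addr0].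
  exists ((2 * c' / (1 - 2 * c)) *: m), ((2 * c' / (1 - 2 * c)) *: w + w').
  have dZ : odd_fraction (2 * c' / (1 - 2 * c)).
    by apply: odd_fractionM => //; apply: odd_fractionM => //; exact: (odd_fraction_nat 2).
  split; [exact: zclosedZ|by apply: (zclosedD SC) => //; apply: (zclosedZ SC)|].
  rewrite scalerDr {1}aE1 !scalerA !scalerDr !scalerA addrA; congr (_ + _ *: _ + _).
  by rewrite mulrC mulrA.
have SM v : S v -> M v by move/(_ M); apply.
move=> v; rewrite inE => /orP[/eqP ->|/lM //].
rewrite aE1; apply: zclosedZ => //; apply: zclosedD => //.
by apply: (zclosed_nat MC 2); apply: SM.
Qed.

End Mod2.
End OddFractions.

Section Lattice.
Variables (F : numFieldType) (V : comAlgType F) (x : nat -> V).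

Definition weight (s : seq nat) : nat := \sum_(i <- s) i.*2.+1.

Definition monom (s : seq nat) : V := \prod_(i <- s) x i.

(* The part of Z_(2)[x_0, x_1, ...] of degree at most d, where x_i has degree
   2 i + 1. *)
Definition lattice (d : nat) : V -> Prop :=
  zspan (fun v => exists2 s, (weight s <= d)%N & v = monom s).

Lemma weight_cons i s : weight (i :: s) = (i.*2.+1 + weight s)%N.
Proof. by rewrite /weight big_cons. Qed.

Lemma monom_cons i s : monom (i :: s) = x i * monom s.
Proof. by rewrite /monom big_cons. Qed.

Lemma lattice_closed d : zclosed (lattice d).
Proof. exact: zspan_closed. Qed.

Lemma lattice_monom d s : (weight s <= d)%N -> lattice d (monom s).
Proof. by move=> sd; apply: zspan_gen; exists s. Qed.

Lemma lattice1 d : lattice d 1.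
Proof. by have := @lattice_monom d [::]; rewrite /weight /monom !big_nil; exact. Qed.

Lemma latticeS d d' v : (d <= d')%N -> lattice d v -> lattice d' v.
Proof.
move=> dd'; apply: zspan_sub => _ [s sd ->]; apply: lattice_monom.
exact: leq_trans dd'.
Qed.

Lemma latticeX d i v : lattice d v -> lattice (i.*2.+1 + d) (x i * v).
Proof.
move=> /(_ (fun v => lattice (i.*2.+1 + d) (x i * v))); apply.
  have [L0 LD LZ] := lattice_closed (i.*2.+1 + d).
  split=> [|u w|c u]; rewrite ?mulr0 ?mulrDr -?scalerAr //; [exact: LD|exact: LZ].
move=> _ [s sd ->]; rewrite -monom_cons; apply: lattice_monom.
by rewrite weight_cons leq_add2l.
Qed.

Lemma latticeM d d' u v : lattice d u -> lattice d' v -> lattice (d + d') (u * v).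
Proof.
move=> ud vd; apply: (ud (fun u => lattice (d + d') (u * v))).
  have [L0 LD LZ] := lattice_closed (d + d').
  split=> [|u' w|c w]; rewrite ?mul0r ?mulrDl -?scalerAl //; [exact: LD|exact: LZ].
move=> _ [s sd ->]; apply: (@latticeS (weight s + d')); first by rewrite leq_add2r.
elim: s {sd} => [|i s IHs]; first by rewrite /weight /monom !big_nil mul1r.
by rewrite weight_cons monom_cons -mulrA -addnA; apply: latticeX.
Qed.

Lemma lattice_x i : lattice i.*2.+1 (x i).
Proof. by rewrite -[x i]mulr1 -[i.*2.+1]addn0; apply: latticeX; apply: lattice1. Qed.

Lemma monoms_finite d : exists l : seq V,
  (forall v, v \in l -> exists2 s, (weight s <= d)%N & v = monom s) /\
  forall s, (weight s <= d)%N -> monom s \in l.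
Proof.
have [l lP] : exists l : seq (seq nat), forall s, (weight s <= d)%N -> s \in l.
  elim: d => [|d [l lP]].
    by exists [:: [::]] => -[_|i s]; [rewrite inE|rewrite weight_cons addSn ltn0].
  exists ([::] :: allpairs cons (iota 0 d.+1) l) => -[_|i s]; first exact: mem_head.
  rewrite weight_cons => sd; rewrite in_cons; apply/orP; right; apply: allpairs_f.
    by rewrite mem_iota; lia.
  by apply: lP; lia.
exists [seq monom s | s <- l & (weight s <= d)%N]; split=> [v|s sd].
  by move=> /mapP[s]; rewrite mem_filter => /andP[sd _] ->; exists s.
by apply: map_f; rewrite mem_filter sd lP.
Qed.

End Lattice.

Lemma sum_double (W : nmodType) (f : nat -> W) m :
  \sum_(a < m.*2) f a = \sum_(s < m) (f s.*2 + f s.*2.+1).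
Proof.
elim: m => [|m IHm]; first by rewrite !big_ord0.
by rewrite doubleS !big_ord_recr /= IHm addrA.
Qed.

Section ExponentialIntegrality.
Variables (F : numFieldType) (V : comAlgType F).
Variables (p E : nat -> V).
Hypothesis E0 : E 0 = 1.
Hypothesis Erec : forall i, i.*2.+1%:R *: E i.*2.+1 =
  - 2 *: \sum_(l < i.+1) p l.*2.+1 * E (i - l).*2.
Hypothesis Eodd : forall n, \sum_(a < n.+2) (-1) ^+ a * E a * E (n.+1 - a)%N = 0.

Let x i : V := 2 ^+ i *: p i.*2.+1.
Let O i : V := (2 ^+ i / 2) *: E i.*2.+1.
Let G i : V := (2 ^+ i / 2) *: E i.*2.+2.

Let two_neq0 : 2 != 0 :> F. Proof. by rewrite pnatr_eq0. Qed.

Local Lemma O_rec i :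
  i.*2.+1%:R *: O i = - x i - 4 *: \sum_(l < i) x l * G (i - l.+1).
Proof.
rewrite /O scalerA mulrC -scalerA Erec scalerA big_ord_recr /= subnn E0 mulr1.
rewrite mulrN mulfVK // scaleNr scalerDr opprD addrC; congr (- _ - _).
rewrite !scaler_sumr; apply: eq_bigr => l _.
have -> : (i - l = (i - l.+1).+1)%N by have := ltn_ord l; lia.
rewrite doubleS /G /x -scalerAl -scalerAr !scalerA; congr (_ *: _).
rewrite -[in LHS](subnKC (ltn_ord l)) exprD exprS; by field.
Qed.

Local Lemma G_rec i : G i =
  \sum_(s < i.+1) O s * O (i - s) - 2 *: \sum_(s < i) G s * G (i - s.+1).
Proof.
pose SO := \sum_(s < i.+1) E s.*2.+1 * E (i - s).*2.+1.
pose SG := \sum_(s < i) E s.*2.+2 * E (i - s.+1).*2.+2.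
have key : 2 *: E i.*2.+2 = SO - SG.
  have := Eodd i.*2.+1; rewrite big_ord_recl expr0 mul1r E0 mul1r subn0.
  under eq_bigr do rewrite /= /bump /= add1n subSS.
  rewrite -doubleS.
  rewrite (sum_double (fun a => (-1) ^+ a.+1 * E a.+1 * E (i.*2.+1 - a)%N)).
  rewrite big_split /= [X in _ + (_ + X)]big_ord_recr /= subnn E0 mulr1.
  rewrite -signr_odd /= odd_double expr0 mul1r.
  have -> : \sum_(s < i.+1) (-1) ^+ s.*2.+1 * E s.*2.+1 * E (i.*2.+1 - s.*2)%N = - SO.
    rewrite -sumrN; apply: eq_bigr => s _.
    rewrite -signr_odd /= odd_double expr1 mulN1r mulNr subSn ?doubleB //.
    by rewrite leq_double -ltnS.
  have -> : \sum_(s < i) (-1) ^+ s.*2.+2 * E s.*2.+2 * E (i.*2.+1 - s.*2.+1)%N = SG.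
    apply: eq_bigr => s _; rewrite -signr_odd /= odd_double expr0 mul1r subSS.
    by congr (_ * E _); have := ltn_ord s; lia.
  move: (E _.*2.+2) => u eq0; apply/eqP; rewrite -subr_eq0 -[X in _ == X]eq0.
  by apply/eqP; rewrite scaler_nat; ring.
have -> : \sum_(s < i.+1) O s * O (i - s) = (2 ^+ i / 4) *: SO.
  rewrite scaler_sumr; apply: eq_bigr => s _.
  have les : (s <= i)%N by rewrite -ltnS.
  rewrite /O -scalerAl -scalerAr scalerA; congr (_ *: _).
  by rewrite -[in RHS](subnKC les) exprD; field.
have -> : \sum_(s < i) G s * G (i - s.+1) = (2 ^+ i / 8) *: SG.
  rewrite scaler_sumr; apply: eq_bigr => s _.
  rewrite /G -scalerAl -scalerAr scalerA; congr (_ *: _).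
  by rewrite -[in RHS](subnKC (ltn_ord s)) exprD exprS; field.
rewrite scalerA (_ : 2 * (2 ^+ i / 8) = 2 ^+ i / 4); last by field.
by rewrite -scalerBr -key scalerA; congr (_ *: _); field.
Qed.

Lemma exponential_integral i : lattice x i.*2.+2 (G i) /\
  lattice x i.*2.+1 (2^-1 *: (O i + i.*2.+1%:R^-1 *: x i)).
Proof.
have oddV j : odd_fraction (j.*2.+1%:R^-1 : F).
  by apply: odd_fractionV; rewrite /= odd_double.
have OL j : lattice x j.*2.+1 (2^-1 *: (O j + j.*2.+1%:R^-1 *: x j)) ->
    lattice x j.*2.+1 (O j).
  move=> H; have LC := @lattice_closed _ _ x j.*2.+1.
  have := zclosedB LC (zclosed_nat LC 2 H) (zclosedZ LC (oddV j) (@lattice_x _ _ x j)).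
  by rewrite scalerA divff // scale1r addrK.
elim/ltn_ind: i => i IHi.
have Oi : lattice x i.*2.+1 (2^-1 *: (O i + i.*2.+1%:R^-1 *: x i)).
  have LC := @lattice_closed _ _ x i.*2.+1.
  have n0 : i.*2.+1%:R != 0 :> F by rewrite pnatr_eq0.
  have -> : O i = i.*2.+1%:R^-1 *: (i.*2.+1%:R *: O i) by rewrite scalerK.
  rewrite O_rec -scalerDr addrAC addNr add0r.
  rewrite scalerA mulrC -scalerA; apply: (zclosedZ LC (oddV i)).
  rewrite scalerN scalerA (_ : 2^-1 * 4 = 2); last by field.
  apply: (zclosedN LC); apply: (zclosed_nat LC 2).
  apply: (zclosed_sum LC) => l _.
  have ltl := ltn_ord l.
  apply: latticeS (latticeM (@lattice_x _ _ x l) (IHi (i - l.+1)%N _).1); lia.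
split=> //; rewrite G_rec; have LC := @lattice_closed _ _ x i.*2.+2.
have OLs s : (s <= i)%N -> lattice x s.*2.+1 (O s).
  by rewrite leq_eqVlt => /orP[/eqP ->|/IHi[_]]; apply: OL.
apply: (zclosedB LC).
  apply: (zclosed_sum LC) => s _.
  apply: latticeS (latticeM (OLs s _) (OLs (i - s)%N _)); have := ltn_ord s; lia.
apply: (zclosed_nat LC 2); apply: (zclosed_sum LC) => s _; have lts := ltn_ord s.
apply: latticeS (latticeM (IHi s _).1 (IHi (i - s.+1)%N _).1); lia.
Qed.

End ExponentialIntegrality.

Lemma linear_scale (F : fieldType) (V : lmodType F) (f : V -> V) b :
  linear f -> linear (fun v => b *: f v).
Proof. by move=> fL a u v; rewrite fL scalerDr !scalerA mulrC. Qed.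

Lemma linear_add (F : fieldType) (V : lmodType F) (f g : V -> V) :
  linear f -> linear g -> linear (fun v => f v + g v).
Proof. by move=> fL gL a u v; rewrite fL gL scalerDr addrACA. Qed.

Section VertexLattice.
Variables (F : numFieldType) (V : comAlgType F).
Variables (p E : nat -> V) (A : int -> V -> V) (d1 : V -> V).
Hypothesis E0 : E 0 = 1.
Hypothesis Erec : forall i, i.*2.+1%:R *: E i.*2.+1 =
  - 2 *: \sum_(l < i.+1) p l.*2.+1 * E (i - l).*2.
Hypothesis Eodd : forall n, \sum_(a < n.+2) (-1) ^+ a * E a * E (n.+1 - a)%N = 0.
Hypothesis A_linear : forall j, linear (A j).
Hypothesis AM : forall j l f, odd l ->
  A j (p l * f) = p l * A j f + 2 *: A (j - l%:Z) f.
Hypothesis A1 : forall j, A j 1 = 2^-1 *: extend0 E (- j).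
Hypothesis d1_linear : linear d1.
Hypothesis d11 : d1 1 = 0.
Hypothesis d1M : forall l f, odd l -> d1 (p l * f) = p l * d1 f + f *+ (1 == l)%N.

Let x i : V := 2 ^+ i *: p i.*2.+1.
Local Notation L := (lattice x).
Let LC d : zclosed (L d). Proof. exact: lattice_closed. Qed.
Let two_neq0 : 2 != 0 :> F. Proof. by rewrite pnatr_eq0. Qed.
Let half2 : 2 * 2^-1 = 1 :> F. Proof. exact: divff. Qed.

Local Lemma AX j l f :
  A j (x l * f) = x l * A j f + 2 ^+ l.+1 *: A (j - l.*2.+1%:Z) f.
Proof.
have A0 : A j 0 = 0.
  by have := A_linear j (-1) 0 0; rewrite scaler0 addr0 scaleN1r addNr.
have AZ a u : A j (a *: u) = a *: A j u.
  by have := A_linear j a u 0; rewrite A0 !addr0.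
rewrite /x -!scalerAl AZ AM /= ?odd_double // scalerDr scalerA.
by rewrite exprSr.
Qed.

Local Lemma closed_linear_le d (M : V -> Prop) (T : V -> V) : linear T ->
  zclosed M -> (forall s, (weight s <= d)%N -> M (T (monom x s))) ->
  forall v, L d v -> M (T v).
Proof.
move=> T_linear MC TM v; move=> /(_ (fun u => M (T u))); apply.
  exact: zclosed_preim.
by move=> _ [s sd ->]; apply: TM.
Qed.

Let odd_part i v := 2^-1 *: (2 ^+ i *: A (- i.*2.+1%:Z) v + i.*2.+1%:R^-1 *: (x i * v)).
Let even_part i v := 2 ^+ i *: A (- i.*2.+2%:Z) v.

Local Lemma odd_partE i v : 2 ^+ i *: A (- i.*2.+1%:Z) v =
  2 *: odd_part i v - i.*2.+1%:R^-1 *: (x i * v).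
Proof. by rewrite scalerA half2 scale1r addrK. Qed.

Local Lemma oddV i : odd_fraction (i.*2.+1%:R^-1 : F).
Proof. by apply: odd_fractionV; rewrite /= odd_double. Qed.

Local Lemma vertex_neg_monom s i :
  L (i.*2.+1 + weight s) (odd_part i (monom x s)) /\
  L (i.*2.+2 + weight s) (even_part i (monom x s)).
Proof.
elim: s i => [|l s IHs] i.
  rewrite /weight /monom !big_nil !addn0 /odd_part /even_part !A1 !opprK /= !scalerA mulr1.
  by have [] := exponential_integral E0 Erec Eodd i.
rewrite weight_cons monom_cons; set m := monom x s in IHs *; split.
  have -> : odd_part i (x l * m) = x l * odd_part i m + even_part (i + l) m.
    rewrite /odd_part AX -scalerAr mulrDr !scalerDr -!scalerAr !scalerA mulrCA addrAC.
    congr (_ + _ + _ *: A _ _); last by lia.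
      by rewrite mulrCA.
    by rewrite exprS exprD; field.
  apply: (zclosedD (LC _)).
    by apply: latticeS (latticeX (i := l) (IHs i).1); lia.
  by apply: latticeS (IHs (i + l)%N).2; lia.
have -> : even_part i (x l * m) =
    x l * even_part i m + 2 ^+ (i + l.+1) *: A (- (i + l.+1).*2.+1%:Z) m.
  rewrite /even_part AX -scalerAr scalerDr scalerA -exprD.
  by congr (_ + _ *: A _ _); lia.
apply: (zclosedD (LC _)).
  by apply: latticeS (latticeX (i := l) (IHs i).2); lia.
rewrite odd_partE; apply: (zclosedB (LC _)).
  by apply: (zclosed_nat (LC _) 2); apply: latticeS (IHs (i + l.+1)%N).1; lia.
apply: (zclosedZ (LC _) (oddV _)).
apply: latticeS (latticeX (lattice_monom (s := s) (leqnn _))); lia.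
Qed.

Lemma vertex_neg_odd i d v : L d v -> L (i.*2.+1 + d)
  (2^-1 *: (2 ^+ i *: A (- i.*2.+1%:Z) v + i.*2.+1%:R^-1 *: (x i * v))).
Proof.
apply: (closed_linear_le (T := odd_part i)) => // [|s sd].
  apply: linear_scale; apply: linear_add; apply: linear_scale => // a u w.
  by rewrite mulrDr scalerAr.
by apply: latticeS (vertex_neg_monom s i).1; lia.
Qed.

Lemma vertex_neg_even i d v : L d v ->
  L (i.*2.+2 + d) (2 ^+ i *: A (- i.*2.+2%:Z) v).
Proof.
apply: (closed_linear_le (T := even_part i)) => // [a u w|s sd].
  by rewrite /even_part A_linear scalerDr !scalerA [a * _]mulrC.
by apply: latticeS (vertex_neg_monom s i).2; lia.
Qed.

Lemma vertex_zero d v : L d v -> L d (2^-1 *: (A 0 v - 2^-1 *: v)).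
Proof.
apply: (closed_linear_le (T := fun v => 2^-1 *: (A 0 v - 2^-1 *: v))) => //.
  apply: linear_scale; apply: linear_add => // a u w.
  by rewrite -!scaleNr scalerDr !scalerA mulrC.
move=> s; elim: s d => [|l s IHs] d.
  rewrite /monom big_nil A1 oppr0 /= E0 subrr scaler0 => _; exact: (zclosed0 (LC _)).
rewrite weight_cons monom_cons; set m := monom x s in IHs * => lsd.
rewrite AX sub0r scalerAr -addrAC -mulrBr scalerDr scalerAr; apply: (zclosedD (LC _)).
  by apply: latticeS (latticeX (i := l) (IHs (weight s) (leqnn _))); lia.
rewrite scalerA exprS mulKf // odd_partE; apply: (zclosedB (LC _)).
  by apply: (zclosed_nat (LC _) 2); apply: latticeS (vertex_neg_monom s l).1; lia.
apply: (zclosedZ (LC _) (oddV _)).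
by rewrite -monom_cons; apply: lattice_monom; rewrite weight_cons.
Qed.

Local Lemma d1X l f : d1 (x l * f) = x l * d1 f + f *+ (l == 0).
Proof.
have d10 : d1 0 = 0.
  by have := d1_linear (-1) 0 0; rewrite scaler0 addr0 scaleN1r addNr.
have d1Z a u : d1 (a *: u) = a *: d1 u.
  by have := d1_linear a u 0; rewrite d10 !addr0.
rewrite /x -!scalerAl d1Z d1M /= ?odd_double // scalerDr.
by case: l => [|l]; rewrite ?scale1r // scaler0.
Qed.

Lemma derivation_lattice d v : L d v -> L d (d1 v).
Proof.
apply: closed_linear_le => // s; elim: s d => [|l s IHs] d.
  by rewrite /monom big_nil d11 => _; exact: (zclosed0 (LC _)).
rewrite weight_cons monom_cons d1X => lsd; apply: (zclosedD (LC _)).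
  by apply: latticeS (latticeX (i := l) (IHs (weight s) (leqnn _))); lia.
rewrite -scaler_nat; apply: (zclosed_nat (LC _)); apply: lattice_monom; lia.
Qed.

Lemma vertex_one d v : L d v -> L d (2^-1 *: (A 1 v - d1 v)).
Proof.
apply: (closed_linear_le (T := fun v => 2^-1 *: (A 1 v - d1 v))) => //.
  apply: linear_scale; apply: linear_add => // a u w.
  by rewrite d1_linear opprD scalerN.
move=> s; elim: s d => [|l s IHs] d.
  by rewrite /monom big_nil A1 d11 /= scaler0 subr0 scaler0 => _; exact: (zclosed0 (LC _)).
rewrite weight_cons monom_cons; set m := monom x s in IHs * => lsd.
rewrite AX d1X opprD addrACA -mulrBr scalerDr scalerAr; apply: (zclosedD (LC _)).
  by apply: latticeS (latticeX (i := l) (IHs (weight s) (leqnn _))); lia.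
have mL : L (weight s) m by apply: lattice_monom.
case: l lsd => [|l] lsd.
  rewrite subrr expr1 scalerDr scalerA mulVf // scale1r.
  have -> : A 0 m + 2^-1 *: - (m *+ true) = 2 *: (2^-1 *: (A 0 m - 2^-1 *: m)).
    by rewrite scalerA half2 scale1r scalerN.
  by apply: (zclosed_nat (LC _) 2); apply: latticeS (vertex_zero mL); lia.
rewrite subr0 scalerA.
have -> : (1 - l.+1.*2.+1%:Z = - l.*2.+2%:Z)%R by lia.
have -> : 2^-1 * 2 ^+ l.+2 = 2 * 2 ^+ l :> F by rewrite !exprS; field.
rewrite -scalerA; apply: (zclosed_nat (LC _) 2).
by apply: latticeS (vertex_neg_even (i := l) mL); lia.
Qed.

Lemma e_lattice d v : L d v ->
  L d (2^-1 *: (d1 v + A 1 v)) /\ L d (2^-1 *: (d1 v - A 1 v)).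
Proof.
move=> Lv; have A1v := vertex_one Lv; split.
  have -> : 2^-1 *: (d1 v + A 1 v) = d1 v + 2^-1 *: (A 1 v - d1 v).
    apply: (scalerI two_neq0); rewrite [in RHS]scalerDr !scalerA half2 !scale1r.
    by rewrite scaler_nat; ring.
  exact: (zclosedD (LC _) (derivation_lattice Lv) A1v).
by rewrite -opprB scalerN; apply: (zclosedN (LC _)).
Qed.

Let x0E : x 0 = p 1. Proof. exact: scale1r. Qed.

Lemma f_lattice d v : L d v ->
  L d.+1 (2^-1 *: (p 1 * v - A (-1) v)) /\ L d.+1 (2^-1 *: (p 1 * v + A (-1) v)).
Proof.
move=> Lv; have := vertex_neg_odd (i := 0) Lv.
rewrite expr0 scale1r invr1 scale1r x0E add1n addrC => f1v; split=> //.
have -> : 2^-1 *: (p 1 * v - A (-1) v) = p 1 * v - 2^-1 *: (p 1 * v + A (-1) v).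
  apply: (scalerI two_neq0); rewrite [in RHS]scalerBr !scalerA half2 !scale1r.
  by rewrite scaler_nat; ring.
apply: (zclosedB (LC _)) => //.
by have := latticeX (i := 0) Lv; rewrite x0E add1n.
Qed.

Section Saturation.
Variable M : V -> Prop.
Hypothesis MC : zclosed M.
Hypothesis M1 : M 1.
Hypothesis Mf0 : forall v, M v -> M (2^-1 *: (p 1 * v - A (-1) v)).
Hypothesis Mf1 : forall v, M v -> M (2^-1 *: (p 1 * v + A (-1) v)).

Local Lemma Mp1 v : M v -> M (p 1 * v).
Proof.
move=> Mv; have := zclosedD MC (Mf0 Mv) (Mf1 Mv).
by rewrite -scalerDr addrACA addNr addr0 -mulr2n -scaler_nat scalerK.
Qed.

(* A_(-2) = [f_1, p_1] *)
Local Lemma MA2 v : M v -> M (A (- 2%:Z) v).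
Proof.
move=> Mv; have := zclosedB MC (Mf1 (Mp1 Mv)) (Mp1 (Mf1 Mv)).
rewrite -scalerAr -scalerBr AM // !mulrDr opprD addrACA subrr add0r addrAC.
by rewrite subrr add0r scalerK.
Qed.

Local Notation N d := (mod2 M (L d)).
Local Lemma NC d : zclosed (N d). Proof. exact: mod2_closed. Qed.

Local Lemma N2 d v : L d v -> N d (2 *: v).
Proof. by move=> Lv; exists 0, v; split=> //; [exact: (zclosed0 MC)|rewrite add0r]. Qed.

Local Lemma NA2 d v : N d v -> N d.+2 (A (- 2%:Z) v).
Proof.
move=> [m [w [Mm Lw ->]]]; exists (A (- 2%:Z) m), (A (- 2%:Z) w).
split; first exact: MA2; last by rewrite addrC A_linear addrC.
by have := vertex_neg_even (i := 0) Lw; rewrite scale1r.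
Qed.

Local Lemma NX i d v : L d v -> N d v -> N (i.*2.+1 + d) (x i * v).
Proof.
elim: i d v => [|i IHi] d v Lv Nv.
  rewrite x0E; case: Nv => m [w [Mm Lw ->]]; exists (p 1 * m), (p 1 * w).
  split; [exact: Mp1| |by rewrite mulrDr scalerAr].
  by have := latticeX (i := 0) Lw; rewrite x0E.
have LA2 : L d.+2 (A (- 2%:Z) v).
  by have := vertex_neg_even (i := 0) Lv; rewrite scale1r.
have NB : N (i.+1.*2.+1 + d) (2 ^+ i.+1 *: A (- i.+1.*2.+1%:Z) v).
  have -> : 2 ^+ i.+1 *: A (- i.+1.*2.+1%:Z) v =
      A (- 2%:Z) (x i * v) - x i * A (- 2%:Z) v.
    by rewrite AX addrAC subrr add0r; congr (_ *: A _ _); lia.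
  apply: (zclosedB (@NC _)).
    by have := NA2 (IHi _ _ Lv Nv); rewrite doubleS !addSn.
  by have := IHi _ _ LA2 (NA2 Nv); rewrite doubleS !addSn !addnS.
have n0 : i.+1.*2.+1%:R != 0 :> F by rewrite pnatr_eq0.
rewrite -[x _ * v](scalerKV n0); apply: (zclosed_nat (@NC _)).
have := zclosedB (@NC _) (N2 (vertex_neg_odd (i := i.+1) Lv)) NB.
by rewrite scalerA half2 scale1r addrAC subrr add0r.
Qed.

Lemma lattice_saturation d v : L d v -> M v.
Proof.
have [l [lmon monl]] := monoms_finite x d.
have lM : forall u, u \in l -> M u.
  apply: (zspan_nakayama MC) => u /lmon[s sd ->].
  have [m [w [Mm Lw ->]]] : N (weight s) (monom x s).
    elim: s {sd} => [|i s IHs].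
      rewrite /weight /monom !big_nil; exists 1, 0; split=> //.
        exact: (zclosed0 (LC _)).
      by rewrite scaler0 addr0.
    by rewrite weight_cons monom_cons; apply: NX => //; apply: lattice_monom.
  exists m, w; split=> //; apply: zspan_sub Lw => _ [t ts ->].
  by apply: zspan_gen; apply: monl; apply: leq_trans sd.
move=> /(_ M); apply=> // _ [s sd ->]; apply: lM; exact: monl.
Qed.

End Saturation.

End VertexLattice.

Lemma leibniz_linear (C : fieldType) (V : comAlgType C) (T : V -> V) q n a u v :
  linear T -> T (q * u) = q * T u + u *+ n -> T (q * v) = q * T v + v *+ n ->
  T (q * (a *: u + v)) = q * T (a *: u + v) + (a *: u + v) *+ n.
Proof.
move=> T_linear qu qv.
rewrite mulrDr -scalerAr !T_linear qu qv mulrDr -scalerAr scalerDr.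
by rewrite addrACA mulrnDl scalerMnr.
Qed.

Section PolynomialDerivation.
Variable C : numFieldType.

Local Notation poly := {malg C[{cmonom nat}]}.

Definition mon (c : C) (m : {cmonom nat}) : poly := << c *g m >>.

Definition partial (i : nat) (f : poly) : poly :=
  \sum_(m <- msupp f) mon (f@_m *+ m i) (divcm m (ucm i)).

Local Lemma monZ c m : mon c m = c *: mon 1 m.
Proof.
apply/malgP => k; rewrite [RHS]mcoeffZ [LHS]mcoeffU mcoeffU.
by rewrite mulrnAr mulr1.
Qed.

Local Lemma monM c m n : mon 1 m * mon c n = mon c (mmul m n).
Proof. by rewrite /mon malgM_def fgmulUU mul1r. Qed.

Local Lemma mon0 m : mon 0 m = 0. Proof. exact: monalgU0. Qed.

Local Lemma monD c d m : mon (c + d) m = mon c m + mon d m.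
Proof. exact: monalgUD. Qed.

Local Lemma mon1 : mon 1 mone = 1. Proof. exact: mpolyC1E. Qed.

Local Lemma monMn c n m : mon (c *+ n) m = mon c m *+ n.
Proof. exact: monalgUMn. Qed.

Lemma partialEw i (d : {fset {cmonom nat}}) f : (msupp f `<=` d)%fset ->
  partial i f = \sum_(m <- d) mon (f@_m *+ m i) (divcm m (ucm i)).
Proof.
move=> fd; rewrite /partial (big_fset_incl _ fd) // => m _ mf.
by rewrite mcoeff_outdom // mul0rn mon0.
Qed.

Lemma partial_linear i : linear (partial i).
Proof.
move=> a u v; pose d := (msupp u `|` msupp v)%fset.
rewrite (@partialEw i d) ?(@partialEw i d u) ?(@partialEw i d v).
- rewrite scaler_sumr -big_split; apply: eq_bigr => m _ /=.
  rewrite mcoeffD mcoeffZ mulrnDl monD -mulrnAr.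
  by rewrite [mon (a * _) _]monZ -scalerA -monZ.
- exact: fsubsetUr.
- exact: fsubsetUl.
by apply: fsubset_trans (msuppD_le _ _) _; apply: fsetSU; apply: msuppZ_le.
Qed.

Lemma partial_mon i c m : partial i (mon c m) = mon (c *+ m i) (divcm m (ucm i)).
Proof.
by rewrite (partialEw i (@msuppU_le _ _ m c)) big_seq_fset1 mcoeffUU.
Qed.

Lemma malg_linear_ind (P : poly -> Prop) : (forall m, P (mon 1 m)) ->
  (forall a u v, P u -> P v -> P (a *: u + v)) -> forall u, P u.
Proof.
move=> PU PD.
have P0 : P 0.
  by have := PD (-1) _ _ (PU mone) (PU mone); rewrite scaleN1r addNr.
move=> u; rewrite [u]monalgE; apply: big_ind => // [v w Pv Pw|m _].
  by rewrite -[v]scale1r; apply: PD.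
by rewrite -/(mon _ _) monZ -[_ *: _]addr0; apply: PD.
Qed.

Lemma monomial_ind (P : {cmonom nat} -> Prop) :
  P mone -> (forall i m, P m -> P (mmul (ucm i) m)) -> forall m, P m.
Proof.
move=> P1 PM m; have [n] := ubnP (mdeg m); elim: n m => // n IHn m ltmn.
have [->//|m1] := eqVneq m mone.
have [i mi] : exists i, (0 < m i)%N.
  apply: contrapT => /forallNP m0; case/eqP: m1; apply/eqP/cmP => i.
  by rewrite cm1; apply/eqP; rewrite -leqn0 leqNgt; apply/negP.
have mE : m = mmul (ucm i) (divcm m (ucm i)).
  by apply/eqP/cmP => j; rewrite cmM divcmE ucmE; case: eqP => [<-|]; lia.
rewrite mE; apply: PM; apply: IHn; move: ltmn.
by rewrite {1}mE mdegM mdegU; lia.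
Qed.

Lemma polyring_ind (P : poly -> Prop) : P 1 ->
  (forall a u v, P u -> P v -> P (a *: u + v)) ->
  (forall i u, P u -> P (mon 1 (ucm i) * u)) -> forall u, P u.
Proof.
move=> P1 PD PM; apply: malg_linear_ind PD => m.
elim/monomial_ind: m => [|i m Pm]; first by rewrite mon1.
by rewrite -monM; apply: PM.
Qed.

Lemma partial1 i : partial i 1 = 0.
Proof. by rewrite -mon1 partial_mon cm1 mulr0n mon0. Qed.

(* Naming the products keeps unification from computing them. *)
Local Lemma partialM_mon i j m q : q = mmul (ucm j) m ->
  partial i (mon 1 q) = mon 1 (ucm j) * partial i (mon 1 m) + mon 1 m *+ (i == j).
Proof.
move=> Eq.
have [q1 Eq1] : exists q1, q1 = divcm q (ucm i) by eexists.
have [m1 Em1] : exists m1, m1 = divcm m (ucm i) by eexists.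
have [m2 Em2] : exists m2, m2 = mmul (ucm j) m1 by eexists.
rewrite [LHS]partial_mon -Eq1 [in RHS]partial_mon -Em1 monM -Em2.
have qE k : q k = ((j == k) + m k)%N by rewrite Eq cmM ucmE.
have q1E k : q1 k = (q k - (i == k))%N by rewrite Eq1 divcmE ucmE.
have m2E k : m2 k = ((j == k) + (m k - (i == k)))%N.
  by rewrite Em2 cmM ucmE Em1 divcmE ucmE.
have q1m2 : (0 < m i)%N -> q1 = m2.
  by move=> mi; apply/eqP/cmP => k; rewrite q1E qE m2E; case: (eqVneq i k) => [<-|]; lia.
have part1 : mon (1 *+ m i) q1 = mon (1 *+ m i) m2.
  by have [->|/q1m2 -> //] := posnP (m i); rewrite mulr0n [LHS]mon0 [RHS]mon0.
have part2 : mon (1 *+ (i == j)) q1 = mon 1 m *+ (i == j).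
  have [ij|_] := eqVneq i j; last first.
    by rewrite monMn; apply: etrans (mulr0n _) (esym (mulr0n _)).
  have -> : q1 = m by apply/eqP/cmP => k; rewrite q1E qE ij addKn.
  exact: monMn.
rewrite qE mulrnDr monD [LHS]addrC [j == i]eq_sym.
by rewrite part1 part2.
Qed.

Lemma partialM i j f :
  partial i (mon 1 (ucm j) * f) = mon 1 (ucm j) * partial i f + f *+ (i == j).
Proof.
elim/malg_linear_ind: f => [m|a u v IHu IHv]; last first.
  exact: (@leibniz_linear C poly (partial i) _ _ a u v (@partial_linear i) IHu IHv).
by rewrite monM; apply: partialM_mon.
Qed.

End PolynomialDerivation.

Lemma fsbig_difference (F : numFieldType) (V : comAlgType F) (E D : nat -> V) (j : int) M :
  (forall m, (M <= m)%N -> D m = 0) ->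
  \sum_(nm \in [set nm : nat * nat | nm.2%:Z - nm.1%:Z = j]%classic) E nm.1 * D nm.2 =
  \sum_(m < M) extend0 E (m%:Z - j) * D m.
Proof.
move=> DM; pose h (m : nat) := (`|m%:Z - j|%N, m).
pose r := [seq h m | m <- iota 0 M & (0 <= m%:Z - j)].
rewrite (@fsbigE _ _ _ _ _ r) /=; last 3 first.
- by rewrite map_inj_uniq ?filter_uniq ?iota_uniq // => m m' [].
- move=> nm /= /mapP[m]; rewrite mem_filter => /andP[m0 _] -> /=.
  by move: m0; lia.
- move=> [n m] /= nmj; have [ltm|lem] := ltnP m M; last by rewrite DM // mulr0.
  case/negP; apply/mapP; exists m; last by rewrite /h -nmj; congr (_, _); lia.
  by rewrite mem_filter mem_iota add0n ltm andbT; lia.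
rewrite big_map big_filter_cond -[in RHS](big_mkord xpredT
  (fun m => extend0 E (m%:Z - j) * D m)) /index_iota subn0 [LHS]big_mkcond /=.
apply: eq_bigr => m _; rewrite /h; case kE: (m%:Z - j) => [k|k] /=; last by rewrite mul0r.
by rewrite mem_set //=; move: kE; lia.
Qed.

Section ExponentialOfP.
Variables (F : numFieldType) (V : comAlgType F) (p : nat -> V).

Let c k : V := if odd k then - (2 / k%:R) *: p k else 0.
Let T k (f : V) := if odd k then - (2 / k%:R) *: (p k * f) else 0.

Local Lemma TE : T = fun k f => c k * f.
Proof.
apply/funext => k; apply/funext => f; rewrite /T /c.
by case: ifP => _; rewrite ?mul0r ?scalerAl.
Qed.

Lemma exp_pE n f : series_exp T n f = series_exp T n 1 * f.
Proof. by rewrite TE; apply: series_exp_mul. Qed.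

Lemma exp_p0 : series_exp T 0 1 = 1.
Proof. by rewrite TE series_exp_mul0. Qed.

Lemma exp_p_rec i : i.*2.+1%:R *: series_exp T i.*2.+1 1 =
  - 2 *: \sum_(l < i.+1) p l.*2.+1 * series_exp T (i - l).*2 1.
Proof.
have /= c_rec := @series_exp_rec F V c (erefl _) i.*2.
rewrite scaler_nat -[LHS]mulr_natl TE c_rec.
have odd_term l u : l.*2.+1%:R * c l.*2.+1 * u = - 2 *: (p l.*2.+1 * u).
  have n0 : l.*2.+1%:R != 0 :> F by rewrite pnatr_eq0.
  rewrite /c /= odd_double /= -scalerAr [_ * p _]mulr_natl -[p _ *+ _]scaler_nat scalerA -scalerAl.
  by rewrite mulNr mulfVK.
rewrite big_ord_recr /= odd_term.
rewrite (sum_double (fun k => k.+1%:R * c k.+1 * series_exp _ (i.*2 - k) 1)).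
rewrite [in RHS]big_ord_recr /= scalerDr scaler_sumr -doubleB; congr (_ + _).
apply: eq_bigr => l _; rewrite odd_term -doubleB /c /= odd_double /=.
by rewrite mulr0 mul0r addr0.
Qed.

Lemma exp_p_odd n :
  \sum_(a < n.+2) (-1) ^+ a * series_exp T a 1 * series_exp T (n.+1 - a) 1 = 0.
Proof. by rewrite TE; apply: series_exp_odd => // k /negbTE ck; rewrite /c ck. Qed.

End ExponentialOfP.

Section BasicRepresentation.
Variables (F : numFieldType) (V : comAlgType F).
Variables (p : nat -> V) (dp : nat -> V -> V) (A : int -> V -> V).
Hypothesis dp_linear : forall k, linear (dp k).
Hypothesis dp1 : forall k, odd k -> dp k 1 = 0.
Hypothesis dpM : forall k l f, odd k -> odd l ->
  dp k (p l * f) = p l * dp k f + f *+ (k == l).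
Hypothesis p_ind : forall P : V -> Prop, P 1 ->
  (forall a u v, P u -> P v -> P (a *: u + v)) ->
  (forall k u, odd k -> P u -> P (p k * u)) -> forall u, P u.

Let Tp k f : V := if odd k then - (2 / k%:R) *: (p k * f) else 0.
Let Td k f : V := if odd k then 2 *: dp k f else 0.

Hypothesis AE : forall j f, A j f = 2^-1 *:
  \sum_(nm \in [set nm : nat * nat | nm.2%:Z - nm.1%:Z = j]%classic)
    series_exp Tp nm.1 (series_exp Td nm.2 f).

Let E n := series_exp Tp n 1.

Local Lemma AE_finite j f M : (forall m, (M <= m)%N -> series_exp Td m f = 0) ->
  A j f = 2^-1 *: \sum_(m < M) extend0 E (m%:Z - j) * series_exp Td m f.
Proof.
move=> Mf; rewrite AE -(@fsbig_difference F V E (fun m => series_exp Td m f) j M Mf).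
congr (_ *: _).
by apply: eq_fsbigr => nm _; rewrite exp_pE.
Qed.

Local Lemma A_linear j : linear (A j).
Proof. exact: (vertex_linear dp_linear dp1 dpM p_ind AE_finite). Qed.

Local Lemma AM j l f : odd l -> A j (p l * f) = p l * A j f + 2 *: A (j - l%:Z) f.
Proof. exact: (vertexM dp_linear dp1 dpM p_ind AE_finite). Qed.

Local Lemma A1 j : A j 1 = 2^-1 *: extend0 E (- j).
Proof. exact: (vertex1 dp_linear dp1 AE_finite). Qed.

Let x i : V := 2 ^+ i *: p i.*2.+1.

Lemma e_lattice_stable d v : lattice x d v ->
  lattice x d (2^-1 *: (dp 1 v + A 1 v)) /\
  lattice x d (2^-1 *: (dp 1 v - A 1 v)).
Proof.
apply: (e_lattice (exp_p0 p) (exp_p_rec p) (exp_p_odd p) A_linear AM A1) => //.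
- exact: dp1.
- by move=> l f ol; apply: dpM.
Qed.

Lemma f_lattice_stable d v : lattice x d v ->
  lattice x d.+1 (2^-1 *: (p 1 * v - A (-1) v)) /\
  lattice x d.+1 (2^-1 *: (p 1 * v + A (-1) v)).
Proof. exact: (f_lattice (exp_p0 p) (exp_p_rec p) (exp_p_odd p) A_linear AM A1). Qed.

Lemma f_linear :
  linear (fun v => 2^-1 *: (p 1 * v - A (-1) v)) /\
  linear (fun v => 2^-1 *: (p 1 * v + A (-1) v)).
Proof.
have p1_linear : linear (fun v => p 1 * v).
  by move=> a u v; rewrite mulrDr scalerAr.
split; apply: linear_scale; apply: linear_add => //; last exact: A_linear.
by move=> a u v; rewrite A_linear opprD scalerN.
Qed.

Lemma lattice_sub_orbit M d v : zclosed M -> M 1 ->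
  (forall u, M u -> M (2^-1 *: (p 1 * u - A (-1) u))) ->
  (forall u, M u -> M (2^-1 *: (p 1 * u + A (-1) u))) ->
  lattice x d v -> M v.
Proof.
move=> MC M1 Mf0 Mf1.
exact: (lattice_saturation (exp_p0 p) (exp_p_rec p) (exp_p_odd p) A_linear AM A1).
Qed.

End BasicRepresentation.

Section Main.
Variable R : realType.
Local Notation V := (polyring R).

Local Lemma pE k : p R k = mon 1 (ucm k./2). Proof. by []. Qed.

Local Lemma dp_linear k : linear (@dp R k).
Proof. exact: (@partial_linear R[i] k./2). Qed.

Local Lemma dp1 k : odd k -> dp k (1 : V) = 0.
Proof. by move=> _; exact: (@partial1 R[i] k./2). Qed.

Local Lemma dpM k l (f : V) : odd k -> odd l ->
  dp k (p R l * f) = p R l * dp k f + f *+ (k == l).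
Proof.
move=> ok ol; have -> : (k == l) = (k./2 == l./2) by lia.
exact: (@partialM R[i] k./2 l./2 f).
Qed.

Local Lemma p_ind (P : V -> Prop) : P 1 ->
  (forall a u v, P u -> P v -> P (a *: u + v)) ->
  (forall k u, odd k -> P u -> P (p R k * u)) -> forall u, P u.
Proof.
move=> P1 PD PM; apply: (@polyring_ind R[i] P P1 PD) => i u Pu.
have := PM i.*2.+1 u; rewrite pE /= uphalf_double odd_double; exact.
Qed.

Local Lemma A_def j (f : V) : A j f = 2^-1 *:
  \sum_(nm \in [set nm : nat * nat | nm.2%:Z - nm.1%:Z = j]%classic)
    series_exp (fun k f => if odd k then - (2 / k%:R) *: (p R k * f) else 0) nm.1
      (series_exp (fun k f => if odd k then 2 *: dp k f else 0) nm.2 f).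
Proof. by []. Qed.

Definition generator i : V := 2 ^+ i *: p R i.*2.+1.

Local Notation L := (lattice generator).

Local Lemma e_stable d v : L d v -> L d (e0 R v) /\ L d (e1 R v).
Proof.
have := @e_lattice_stable R[i] V (p R) (@dp R) (@A R) dp_linear dp1 dpM p_ind A_def d v.
by rewrite /e0 /e1 /alpha scale1r; exact.
Qed.

Local Lemma f_stable d v : L d v -> L d.+1 (f0 R v) /\ L d.+1 (f1 R v).
Proof.
exact: (@f_lattice_stable R[i] V (p R) (@dp R) (@A R) dp_linear dp1 dpM p_ind A_def d v).
Qed.

Local Lemma f0_linear : linear (f0 R).
Proof.
exact: (@f_linear R[i] V (p R) (@dp R) (@A R) dp_linear dp1 dpM p_ind A_def).1.
Qed.

Local Lemma f1_linear : linear (f1 R).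
Proof.
exact: (@f_linear R[i] V (p R) (@dp R) (@A R) dp_linear dp1 dpM p_ind A_def).2.
Qed.

Local Lemma lattice_sub M d v : zclosed M -> M 1 ->
  (forall u, M u -> M (f0 R u)) -> (forall u, M u -> M (f1 R u)) -> L d v -> M v.
Proof.
exact: (@lattice_sub_orbit R[i] V (p R) (@dp R) (@A R) dp_linear dp1 dpM p_ind A_def M d v).
Qed.

Lemma Delta_lattice v : Delta R v <-> exists d, L d v.
Proof.
split.
  move=> /(_ [set u | exists d, L d u]%classic); apply; split.
    split=> [|u w|u w].
    - by rewrite inE; exists 0; apply: lattice1.
    - rewrite !inE => -[d Lu] [d' Lw]; exists (d + d')%N.
      apply: (zclosedB (@lattice_closed _ _ _ _)).
        exact: latticeS (leq_addr _ _) Lu.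
      exact: latticeS (leq_addl _ _) Lw.
    - rewrite !inE => -[d Lu] [d' Lw]; exists (d + d')%N; exact: latticeM.
  move=> _ [[c cZ <-]|[k _ <-]]; last first.
    by exists k.*2.+1; apply: (@lattice_x _ _ generator k).
  exists 0; rewrite -[c%:MP]mulr1 mul_malgC.
  by apply: (zclosedZ (@lattice_closed _ _ _ _)) => //; apply: lattice1.
move=> [d Lv] B [[B1 BB BM] GB].
have B0 : B 0 by have := BB _ _ B1 B1; rewrite subrr inE.
have BMp u w : B u -> B w -> B (u * w).
  by move=> Bu Bw; have := BM u w; rewrite !inE; apply.
have BN u : B u -> B (- u).
  by move=> Bu; have := BB 0 u; rewrite !inE sub0r; apply.
apply: (Lv B).
  split=> // [u w Bu Bw|c u cZ Bu].
    by rewrite -[w]opprK; have := BB u (- w); rewrite !inE; apply=> //; apply: BN.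
  rewrite -mul_malgC; apply: BMp => //; apply: GB; left; by exists c.
move=> _ [s _ ->]; elim: s => [|i s IHs].
  by move: B1; rewrite /monom big_nil inE.
rewrite monom_cons; apply: BMp => //; apply: GB; right; by exists i.
Qed.

Local Lemma orbit_closed (S : set (V -> V)) : zclosed (Z2orbit S : V -> Prop).
Proof.
split=> [M [[M0 _ _] _]|u w uS wS M MS|c u cZ uS M MS] //.
  by case: (MS) => -[_ MD _] _; apply: MD; [apply: uS|apply: wS].
by case: (MS) => -[_ _ MZ] _; apply: MZ => //; apply: uS.
Qed.

Local Lemma orbit1 (S : set (V -> V)) : Z2orbit S 1.
Proof. by move=> M [_]; apply; exists [::]. Qed.

Local Lemma orbit_stable (S : set (V -> V)) (X : V -> V) :
  linear X -> S X -> forall v, Z2orbit S v -> Z2orbit S (X v).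
Proof.
move=> X_linear SX v.
move=> /(_ [set u | Z2orbit S (X u)]%classic); apply; split.
  have preim_closed := @zclosed_preim R[i] V _ (orbit_closed S) X X_linear.
  exact preim_closed.
move=> _ [Xs XsS ->] M [_]; apply; exists (X :: Xs) => // -[|i] //=.
by rewrite ltnS; apply: XsS.
Qed.

Local Lemma orbit_sub_lattice (S : set (V -> V)) :
  (forall X, S X -> forall d v, L d v -> L d.+1 (X v)) ->
  (Z2orbit S `<=` Delta R)%classic.
Proof.
move=> SL v; move=> /(_ (Delta R)); apply; split.
  split=> [|u w /Delta_lattice[d Lu] /Delta_lattice[d' Lw]|c u cZ /Delta_lattice[d Lu]];
    apply/Delta_lattice.
  - by exists 0; apply: (zclosed0 (@lattice_closed _ _ _ _)).
  - exists (d + d')%N; apply: (zclosedD (@lattice_closed _ _ _ _)).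
      exact: latticeS (leq_addr _ _) Lu.
    exact: latticeS (leq_addl _ _) Lw.
  - by exists d; apply: (zclosedZ (@lattice_closed _ _ _ _)).
move=> _ [Xs XsS ->]; apply/Delta_lattice.
elim: Xs XsS => [|X Xs IHXs] XsS; first by exists 0; apply: lattice1.
have [i iXs|d Ld] := IHXs; first exact: (XsS i.+1).
by exists d.+1; apply: SL => //; apply: (XsS 0).
Qed.

Local Lemma orbit_mono (S S' : set (V -> V)) :
  (S `<=` S')%classic -> (Z2orbit S `<=` Z2orbit S')%classic.
Proof.
move=> SS' v Sv M [MC MS']; apply: Sv; split=> // _ [Xs XsS ->].
by apply: MS'; exists Xs => // i /XsS/SS'.
Qed.

Local Lemma Delta_sub_orbit :
  (Delta R `<=` Z2orbit [set f0 R; f1 R])%classic.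
Proof.
move=> v /Delta_lattice[d Lv].
apply: (@lattice_sub (Z2orbit [set f0 R; f1 R]) d v (@orbit_closed _) (@orbit1 _) _ _ Lv) => u.
- by apply: orbit_stable; [exact: f0_linear|left].
- by apply: orbit_stable; [exact: f1_linear|right].
Qed.

Local Lemma orbit_ef_sub_Delta :
  (Z2orbit [set e0 R; e1 R; f0 R; f1 R] `<=` Delta R)%classic.
Proof.
apply: orbit_sub_lattice => X [[[->|->]|->]|->] d v Lv.
- exact: latticeS (leqnSn _) (e_stable Lv).1.
- exact: latticeS (leqnSn _) (e_stable Lv).2.
- exact: (f_stable Lv).1.
- exact: (f_stable Lv).2.
Qed.

End Main.

Local Open Scope classical_set_scope.

Theorem theorem3p5 (R : realType) :
  Z2orbit [set f0 R; f1 R] = Z2orbit [set e0 R; e1 R; f0 R; f1 R] /\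
  Z2orbit [set e0 R; e1 R; f0 R; f1 R] = Delta R.
Proof.
have f_ef : Z2orbit [set f0 R; f1 R] `<=` Z2orbit [set e0 R; e1 R; f0 R; f1 R].
  by apply: orbit_mono => X [->|->]; [left; right|right].
have ef_D := @orbit_ef_sub_Delta R; have D_f := @Delta_sub_orbit R.
split; apply/seteqP; split=> //.
  exact: subset_trans ef_D D_f.
exact: subset_trans D_f f_ef.
Qed.
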